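(* Let $W(x)=e^{-x^2}Z(x)$, $x\in\mathbb{R}$, be an $N\times N$ Hermite-type weight matrix such that $W(x)=W(-x)$, and let $U(y)=y^{1/2}e^{-y}Z(\sqrt{y})$, $y\in(0,\infty)$, be the associated Laguerre-type weight with parameter $\alpha=\tfrac12$. Let $D\in\mathcal{D}(W)$, let $E$ be the differential operator defined by $Ex=xD$, i.e. $x\,(F\cdot E)(x)=((xF)\cdot D)(x)$ for all smooth matrix functions $F$, and let $\tilde E$ be the operator in the variable $y=x^2$ determined by $(F\cdot E)(\sqrt y)=(\tilde F\cdot\tilde E)(y)$ where $\tilde F(y)=F(\sqrt y)$. Then $\tilde E\in\mathcal{D}(U)$.
   Context: An $N\times N$ weight matrix on an interval $I$ is integrable, positive definite a.e., with exponential decay at infinity and finite moments; it defines $\langle P,Q\rangle_W=\int_I P(x)W(x)Q(x)^*dx$ and a unique sequence of monic orthogonal matrix polynomials $\{P_n\}_{n\ge0}$. Differential operators $\sum_i \frac{d^i}{dx^i}F_i(x)$ act on the right: $P\cdot\sum_i \frac{d^i}{dx^i}F_i=\sum_i P^{(i)}F_i$, and compositions act successively left to right. $\mathcal{D}(W)$ is the algebra of such operators with matrix polynomial coefficients for which there are constant matrices $\Lambda_n$ with $P_n\cdot D=\Lambda_nP_n$ for all $n\ge0$. Hermite-type weight: weight on $\mathbb{R}$ of the form $e^{-x^2}Z(x)$; Laguerre-type weight: weight on $(0,\infty)$ of the form $y^\alpha e^{-y}Z(y)$, $\alpha>-1$. *)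

(* Defs.v *)
From HB Require Import structures.
From mathcomp Require Import all_boot all_order all_algebra.
From mathcomp Require Import all_classical all_reals all_analysis.
From mathcomp Require Import complex.
Set Implicit Arguments. Unset Strict Implicit. Unset Printing Implicit Defensive.
Import Order.TTheory GRing.Theory Num.Theory.
Local Open Scope ring_scope.
Local Open Scope classical_set_scope.

Definition Cx {R : realType} (x : R) : R[i] := (x%:C)%C.

Definition cmx {R : realType} {n : nat} (x : R) : 'M[R[i]]_n := (Cx x)%:M.

Definition mx_ctrans {R : realType} {m n : nat} (A : 'M[R[i]]_(m, n))
  : 'M[R[i]]_(n, m) := map_mx Num.conj A^T.

Definition Cintegrable {R : realType} (A : set R) (f : R -> R[i]) : Prop :=
  (@lebesgue_measure R).-integrable A (EFin \o (fun x => @complex.Re R (f x))) /\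
  (@lebesgue_measure R).-integrable A (EFin \o (fun x => @complex.Im R (f x))).

Definition Cint {R : realType} (A : set R) (f : R -> R[i]) : R[i] :=
  ((Rintegral (@lebesgue_measure R) A (fun x => @complex.Re R (f x))) +i*
   (Rintegral (@lebesgue_measure R) A (fun x => @complex.Im R (f x))))%C.

Definition mxint {R : realType} {n : nat} (A : set R) (F : R -> 'M[R[i]]_n)
  : 'M[R[i]]_n := \matrix_(i, j) Cint A (fun x => F x i j).

Definition posdef {R : realType} {n : nat} (M : 'M[R[i]]_n) : Prop :=
  forall v : 'rV[R[i]]_n, v != 0 -> 0 < (v *m M *m mx_ctrans v) 0 0.

Definition is_weight {R : realType} {n : nat} (I : set R)
  (W : R -> 'M[R[i]]_n) : Prop :=
  [/\ (forall i j, Cintegrable I (fun x => W x i j)),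
      {ae (@lebesgue_measure R), forall x, I x -> posdef (W x)},
      (exists c : R, 0 < c /\ exists K M : R,
         forall x, I x -> M <= `|x| -> forall i j,
           Normc.normc (W x i j) <= K * expR (- (c * `|x|))) &
      (forall (k : nat) i j, Cintegrable I (fun x => Cx (x ^+ k) * W x i j))].

Notation mxpoly R n := {poly 'M[R[i]]_n.+1}.

Definition ip {R : realType} {n : nat} (I : set R) (W : R -> 'M[R[i]]_n.+1)
  (P Q : mxpoly R n) : 'M[R[i]]_n.+1 :=
  mxint I (fun x => P.[cmx x] *m W x *m mx_ctrans Q.[cmx x]).

Definition monic_OPS {R : realType} {n : nat} (I : set R)
  (W : R -> 'M[R[i]]_n.+1) (P : nat -> mxpoly R n) : Prop :=
  (forall k, P k \is monic /\ size (P k) = k.+1) /\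
  (forall k l, k <> l -> ip I W (P k) (P l) = 0).

(* differential operator sum_i d^i/dx^i F_i with matrix polynomial coefficients,
   given by its list of coefficients [:: F_0; F_1; ...] *)
Definition diffop (R : realType) (n : nat) := seq (mxpoly R n).

Definition actP {R : realType} {n : nat} (P : mxpoly R n) (D : diffop R n)
  : mxpoly R n := \sum_(i < size D) derivn i P * D`_i.

(* D \in \mathcal D(W): P_k . D = Lambda_k P_k for the monic orthogonal
   polynomials of W (which exist and are unique for a weight). *)
Definition inD {R : realType} {n : nat} (I : set R) (W : R -> 'M[R[i]]_n.+1)
  (D : diffop R n) : Prop :=
  forall P, monic_OPS I W P ->
    forall k, exists L : 'M[R[i]]_n.+1, actP (P k) D = L%:P * P k.

Definition Cderivn {R : realType} (k : nat) (f : R -> R[i]) (x : R) : R[i] :=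
  ((derive1n k (fun t => @complex.Re R (f t)) x) +i* (derive1n k (fun t => @complex.Im R (f t)) x))%C.

Definition Csmooth {R : realType} (A : set R) (f : R -> R[i]) : Prop :=
  forall (k : nat) x, A x ->
    derivable (derive1n k (fun t => @complex.Re R (f t))) x 1 /\
    derivable (derive1n k (fun t => @complex.Im R (f t))) x 1.

Definition mxsmooth {R : realType} {n : nat} (A : set R) (F : R -> 'M[R[i]]_n)
  : Prop := forall i j, Csmooth A (fun t => F t i j).

Definition mxderivn {R : realType} {n : nat} (k : nat) (F : R -> 'M[R[i]]_n)
  (x : R) : 'M[R[i]]_n := \matrix_(i, j) Cderivn k (fun t => F t i j) x.

Definition actF {R : realType} {n : nat} (D : diffop R n)
  (F : R -> 'M[R[i]]_n.+1) (x : R) : 'M[R[i]]_n.+1 :=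
  \sum_(i < size D) mxderivn i F x * (D`_i).[cmx x].

(* the operator E defined by E x = x D, i.e. x (F . E)(x) = ((x F) . D)(x);
   its action at x <> 0 *)
Definition actE {R : realType} {n : nat} (D : diffop R n)
  (F : R -> 'M[R[i]]_n.+1) (x : R) : 'M[R[i]]_n.+1 :=
  (Cx x)^-1 *: actF D (fun t => Cx t *: F t) x.

Definition laguerre_assoc {R : realType} {n : nat} (Z : R -> 'M[R[i]]_n)
  (y : R) : 'M[R[i]]_n :=
  Cx (Num.sqrt y * expR (- y)) *: Z (Num.sqrt y).

(* Main.v *)
Require Import Defs.
From HB Require Import structures.
From mathcomp Require Import all_boot all_order all_algebra.
From mathcomp Require Import all_classical all_reals all_analysis.
From mathcomp Require Import measurable_realfun.
From mathcomp Require Import complex.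
From mathcomp Require Import ring lra.
Import Order.TTheory GRing.Theory Num.Theory.
Import numFieldNormedType.Exports.
Local Open Scope ring_scope.

(** For matrix polynomials [Q_k], the substitution [y = x^2] turns
    orthogonality of [(Q_k)] for [U] into orthogonality of [(x Q_k(x^2))] for
    [W]. As [W] is even, these odd polynomials are moreover orthogonal to every
    even one, so together with the Gram-Schmidt family of the even polynomials
    they form the monic orthogonal sequence of [W]; hence [D] multiplies each
    [x Q_k(x^2)] on the left by a constant matrix. Since
    [(x G(x^2)) . D = \sum_m G^(m)(x^2) c_m(x)] with polynomials [c_m], applying
    this to [G = Q_0, Q_1, ...] in turn shows that every [c_m] is odd, say
    [c_m(x) = x e_m(x^2)], and [E~ = \sum_m (d/dy)^m e_m] satisfies
    [(x G(x^2)) . D = x (G . E~)(x^2)]: dividing by [x] gives the action of [E],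
    and taking [G = Q_k] gives the eigenvalue equation for [Q_k]. *)

(** * Operators under the substitution [y = x^2] *)

Section CompSquare.
Variable K : nzRingType.
Implicit Types p q : {poly K}.

(** Over a noncommutative ring composition need not be multiplicative; here it is because ['X^2]
    commutes with every coefficient. *)
Lemma comp_sqrM p q : (p * q) \Po 'X^2 = (p \Po 'X^2) * (q \Po 'X^2).
Proof.
by rewrite /comp_poly rmorphM hornerM_comm //; exact/esym/commr_polyXn.
Qed.

Lemma deriv_comp_sqr p :
  (p \Po 'X^2)^`() = (p^`() \Po 'X^2) * ('X *+ 2).
Proof.
elim/poly_ind: p => [|p c IH]; first by rewrite !(comp_poly0, deriv0, mul0r).
rewrite comp_poly_MXaddC derivD derivC addr0 derivM IH derivXn /=.
rewrite derivD derivC addr0 derivM derivX mulr1 comp_polyD comp_sqrM.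
rewrite comp_polyX mulrDl expr1; congr (_ + _).
by rewrite -[LHS]mulrA -[RHS]mulrA (commr_polyXn ('X *+ 2) 2).
Qed.

Lemma even_comp_sqr p : even_poly (p \Po 'X^2) = p.
Proof.
apply/polyP => i; rewrite coef_even_poly coef_comp_poly_Xn // -muln2.
by rewrite dvdn_mull // mulnK.
Qed.

Lemma odd_comp_sqr p : odd_poly (p \Po 'X^2) = 0.
Proof.
apply/polyP => i; rewrite coef_odd_poly coef_comp_poly_Xn // coef0.
by rewrite dvdn2 /= odd_double.
Qed.

Lemma even_comp_sqrX p : even_poly ((p \Po 'X^2) * 'X) = 0.
Proof. by rewrite even_polyMX odd_comp_sqr mul0r. Qed.

Lemma odd_comp_sqrX p : odd_poly ((p \Po 'X^2) * 'X) = p.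
Proof. by rewrite odd_polyMX even_comp_sqr. Qed.

(** A factor in [x^2] preserves parity, so the even part can be read off term by term in a sum of
    such products. *)
Lemma even_poly_comp_sqrM p q : even_poly ((p \Po 'X^2) * q) = p * even_poly q.
Proof.
rewrite -{1}[q]poly_even_odd mulrDr even_polyD mulrA -!comp_sqrM.
by rewrite even_comp_sqr even_comp_sqrX addr0.
Qed.

Lemma monic_comp_sqr p n : p \is monic -> size p = n.+1 ->
  p \Po 'X^2 \is monic /\ size (p \Po 'X^2) = n.*2.+1.
Proof.
move=> pm sp.
have c2 : (p \Po 'X^2)`_n.*2 = 1.
  rewrite -(coef_even_poly (p \Po 'X^2)) even_comp_sqr.
  by rewrite -(monicP pm) lead_coefE sp.
have sz : size (p \Po 'X^2) = n.*2.+1.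
  apply/eqP; rewrite eqn_leq; apply/andP; split; last first.
    rewrite ltnNge; apply/negP => /leq_sizeP/(_ _ (leqnn _)) /eqP.
    by rewrite c2 oner_eq0.
  apply/leq_sizeP => j jp; rewrite coef_comp_poly_Xn //.
  case: ifP => // /dvdnP[k jE]; rewrite jE mulnK // nth_default // sp.
  by move: jp; rewrite jE muln2 ltn_double.
by split=> //; apply/monicP; rewrite lead_coefE sz.
Qed.

Lemma monic_comp_sqrX p n : p \is monic -> size p = n.+1 ->
  (p \Po 'X^2) * 'X \is monic /\ size ((p \Po 'X^2) * 'X) = n.*2.+2.
Proof.
move=> pm sp; have [qm qs] := monic_comp_sqr p n pm sp.
by split; [rewrite rpredM // monicX | rewrite size_mulX ?monic_neq0 // qs].
Qed.

(* [x G(x^2)] differentiated [i] times is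
   [\sum_m G^(m)(x^2) * sqr_coef i m]. *)
Fixpoint sqr_coef i m : {poly K} :=
  match i with
  | 0 => if m == 0 then 'X else 0
  | i'.+1 => (sqr_coef i' m)^`() +
             (if m is m'.+1 then 'X *+ 2 * sqr_coef i' m' else 0)
  end.

Lemma sqr_coef_gt i m : (i < m)%N -> sqr_coef i m = 0.
Proof.
elim: i m => [|i IH] [|m] //= im; rewrite !IH ?deriv0 ?mulr0 ?addr0 //.
exact: ltnW.
Qed.

Lemma derivn_comp_sqrX p i n : (i < n)%N ->
  ((p \Po 'X^2) * 'X)^`(i) = \sum_(m < n) (p^`(m) \Po 'X^2) * sqr_coef i m.
Proof.
elim: i n => [|i IH] [|n] // lin.
  rewrite big_ord_recl derivn0 big1 ?addr0 // => j _.
  by rewrite /= mulr0.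
rewrite derivnS (IH n.+1) ?(ltnW lin) // raddf_sum /=.
under eq_bigr do rewrite derivM deriv_comp_sqr -derivnS.
rewrite big_split /= addrC.
under [RHS]eq_bigr do rewrite /= mulrDr.
rewrite big_split /=; congr (_ + _).
(* The chain-rule terms match after a shift of [m] by one: the last one on the left vanishes since
   [i < n], and the one for [m = 0] on the right is zero. *)
rewrite big_ord_recr [RHS]big_ord_recl /= sqr_coef_gt ?mulr0 // addr0 add0r.
by apply: eq_bigr => j _; rewrite mulrA.
Qed.

End CompSquare.

(** [sqr_coef] has integer coefficients, so any ring morphism carries it to its counterpart. This
    lets derivatives of real functions be compared with operators on matrix polynomials. *)
Lemma map_sqr_coef (K L : nzRingType) (f : {rmorphism K -> L}) i m :
  map_poly f (sqr_coef K i m) = sqr_coef L i m.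
Proof.
elim: i m => [|i IH] [|m] /=; rewrite ?map_polyX ?rmorph0 ?addr0 //.
  by rewrite -deriv_map IH.
by rewrite rmorphD rmorphM rmorphMn /= map_polyX -deriv_map !IH.
Qed.

Lemma derivn_monic (K : nzRingType) (p : {poly K}) m :
  p \is monic -> size p = m.+1 -> p^`(m) = (m`!)%:R.
Proof.
move=> pm sp; apply/polyP => i; rewrite coef_derivn -polyC_natr coefC.
case: i => [|i] /=.
  rewrite addn0 ffactnn; move/monicP: pm; rewrite lead_coefE sp /= => ->.
  by [].
by rewrite nth_default ?mul0rn // sp addnS ltnS leq_addr.
Qed.

(** * Gram-Schmidt orthogonalization over a noncommutative ring *)

Section GramSchmidt.
Variables (K : unitRingType) (f : {poly K} -> {poly K} -> K).
Hypothesis fD : forall p q r, f (p + q) r = f p r + f q r.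
Hypothesis fZ : forall c p r, f (c%:P * p) r = c * f p r.
Hypothesis fC : forall p q, f p q = 0 -> f q p = 0.
Hypothesis fU : forall p, p \is monic -> f p p \is a GRing.unit.

(** Projection coefficients stand on the left, the side on which [f] is linear in its first
    argument. *)
Let step n (s : seq {poly K}) : {poly K} :=
  'X^n - \sum_(q <- s) (f 'X^n q * (f q q)^-1)%:P * q.
Let gs := fix gs n :=
  if n is n'.+1 then rcons (gs n') (step n' (gs n')) else [::].

(** Each new member is ['X^n] minus its projections on the earlier ones. Those have lower degree, so
    it stays monic, and the inverses exist by [fU]. *)
Lemma gram_schmidt : exists P : nat -> {poly K},
  (forall k, P k \is monic /\ size (P k) = k.+1) /\
  (forall k l, k <> l -> f (P k) (P l) = 0).
Proof.
pose P n := step n (gs n).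
have gsE n : gs n = [seq P i | i <- iota 0 n].
  by elim: n => // n IH; rewrite -[n.+1]addn1 iotaD map_cat -IH cats1 addn1.
pose c n i := (f 'X^n (P i) * (f (P i) (P i))^-1)%:P.
have PE n : P n = 'X^n - \sum_(i < n) c n i * P i.
  rewrite {1}/P /step gsE big_map; congr (_ - _).
  by rewrite -(big_mkord xpredT (fun i => c n i * P i)) /index_iota subn0.
have Pm n : P n \is monic /\ size (P n) = n.+1.
  elim/ltn_ind: n => n IH.
  pose S := \sum_(i < n) c n i * P i.
  have sz : (size S <= n)%N.
    rewrite (leq_trans (size_sum _ _ _)) //; apply/bigmax_leqP => i _.
    rewrite /c mul_polyC (leq_trans (size_scale_leq _ _)) //.
    by have [_ ->] := IH i (ltn_ord i).
  rewrite PE; split; last by rewrite size_polyDl size_polyXn // size_polyN ltnS.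
  apply/monicP; rewrite lead_coefDl ?lead_coefXn //.
  by rewrite size_polyXn size_polyN ltnS.
exists P; split=> //.
have f0 r : f 0 r = 0.
  by apply: (addrI (f 0 r)); rewrite -fD !addr0.
have fN p r : f (- p) r = - f p r.
  by apply/eqP; rewrite -addr_eq0 -fD addNr f0.
have fS n (F : 'I_n -> {poly K}) r :
    f (\sum_(i < n) F i) r = \sum_(i < n) f (F i) r.
  exact: (big_morph (fun p => f p r) (fun p q => fD p q r) (f0 r)).
suff lt n : forall l, (l < n)%N -> f (P n) (P l) = 0.
  by move=> k l /eqP; rewrite neq_ltn => /orP[kl|lk]; [apply/fC|]; exact: lt.
elim/ltn_ind: n => n IH l ln.
(* The projection on [P l] cancels [f 'X^n (P l)]; the other terms vanish by induction, applied at
   the larger of the two indices. *)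
rewrite PE fD fN fS (bigD1 (Ordinal ln)) //= fZ divrK; last first.
  by apply/fU; have [] := Pm l.
rewrite big1 ?addr0 ?subrr // => i /eqP il; rewrite fZ.
have {}il : i <> l :> nat by move=> e; apply: il; exact: val_inj.
suff -> : f (P i) (P l) = 0 by rewrite mulr0.
move/eqP: il; rewrite neq_ltn => /orP[il|li]; last exact: IH.
by apply/fC/IH.
Qed.

End GramSchmidt.

(** * The transformed operator and its eigenvalue equation *)

Section OperatorUnderSquare.
Variables (K : nzRingType) (D : seq {poly K}).
Hypothesis K0 : forall n (a : K), a *+ n.+1 = 0 -> a = 0.

(** This is the sum [actP], over an arbitrary coefficient ring. *)
Definition right_act (P : {poly K}) (D : seq {poly K}) : {poly K} :=
  \sum_(i < size D) derivn i P * D`_i.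

(** The coefficient of [G^(m)(x^2)] in [(x G(x^2)) . D]. *)
Definition sqr_op_coef m : {poly K} :=
  \sum_(i < size D) sqr_coef K i m * D`_i.

(** Once a coefficient is known to be [x e(x^2)], its [odd_poly] is exactly [e]. *)
Definition sqr_op : seq {poly K} :=
  mkseq (fun m => odd_poly (sqr_op_coef m)) (size D).

Lemma right_act_comp_sqrX p : right_act ((p \Po 'X^2) * 'X) D =
  \sum_(m < size D) (p^`(m) \Po 'X^2) * sqr_op_coef m.
Proof.
under [RHS]eq_bigr do rewrite big_distrr /=.
rewrite exchange_big /=; apply: eq_bigr => i _.
rewrite (derivn_comp_sqrX _ p i (size D)) ?ltn_ord // big_distrl /=.
by apply: eq_bigr => j _; rewrite mulrA.
Qed.

Variable Q : nat -> {poly K}.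
Hypothesis Qm : forall k, Q k \is monic /\ size (Q k) = k.+1.
Hypothesis QD : forall k, exists c : K,
  right_act ((Q k \Po 'X^2) * 'X) D = c%:P * ((Q k \Po 'X^2) * 'X).

(* [Q_m] kills the terms of order above [m] and turns the one of order [m] into
   [m! c_m], so [c_m] is odd once all [c_l], [l < m], are. *)
Lemma even_sqr_op_coef m : (m < size D)%N -> even_poly (sqr_op_coef m) = 0.
Proof.
elim/ltn_ind: m => m IH mD; have [c] := QD m; have [Qmm Qms] := Qm m.
rewrite right_act_comp_sqrX => /(congr1 (@even_poly K)).
(* The eigenvalue is a constant, so the right-hand side is still [x] times a polynomial in [x^2] and
   has no even part. *)
rewrite mulrA -{1}(comp_polyC c 'X^2) -comp_sqrM even_comp_sqrX.
rewrite (big_morph _ (@even_polyD K) (even_polyC 0)).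
rewrite (bigD1 (Ordinal mD)) //= big1 => [|i im]; last first.
  rewrite even_poly_comp_sqrM; have [im'|mi] := ltnP i m.
    by rewrite IH ?mulr0 // ltn_ord.
  rewrite derivn_poly0 ?mul0r // Qms ltn_neqAle mi andbT.
  by apply: contra im => /eqP im; apply/eqP/val_inj.
rewrite addr0 even_poly_comp_sqrM derivn_monic // mulr_natl => /polyP e0.
(* What remains is [m!] times the even part; [K0] cancels the factorial. *)
apply/polyP => i; have := e0 i; rewrite coefMn !coef0.
by have := fact_gt0 m; case: m`! => // k _; exact: K0.
Qed.

Lemma sqr_op_coefE m : (m < size D)%N ->
  sqr_op_coef m = (odd_poly (sqr_op_coef m) \Po 'X^2) * 'X.
Proof.
move=> mD; rewrite -[LHS]poly_even_odd even_sqr_op_coef // comp_poly0.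
by rewrite add0r.
Qed.

Lemma right_act_sqr_op p :
  right_act ((p \Po 'X^2) * 'X) D = (right_act p sqr_op \Po 'X^2) * 'X.
Proof.
rewrite right_act_comp_sqrX /right_act size_mkseq raddf_sum /= big_distrl /=.
apply: eq_bigr => m _; rewrite sqr_op_coefE ?ltn_ord // nth_mkseq ?ltn_ord //.
by rewrite comp_sqrM mulrA.
Qed.

Lemma right_act_sqr_op_eigen p c :
  right_act ((p \Po 'X^2) * 'X) D = c%:P * ((p \Po 'X^2) * 'X) ->
  right_act p sqr_op = c%:P * p.
Proof.
rewrite right_act_sqr_op mulrA -{1}(comp_polyC c 'X^2) -comp_sqrM.
by move=> /(congr1 (@odd_poly K)); rewrite !odd_comp_sqrX.
Qed.

End OperatorUnderSquare.

Local Open Scope classical_set_scope.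

(** * Measures with a density, and the change of variables [y = x^2] *)

Section Density.
Local Open Scope ereal_scope.
Context d (T : measurableType d) (R : realType).
Context (mu : {measure set T -> \bar R}).
Context (w : T -> R) (mw : measurable_fun setT w) (w0 : forall x, (0 <= w x)%R).

(* The two hypotheses are arguments of [density] so that its measure instance
   can find them. *)
Definition density of measurable_fun setT w & (forall x, 0 <= w x)%R :=
  fun A : set T => \int[mu]_(x in A) (w x)%:E.

Local Notation nu := (density mw w0).

Let nu0 : nu set0 = 0. Proof. exact: integral_set0. Qed.

Let nu_ge0 A : 0 <= nu A.
Proof. by apply: integral_ge0 => x _; rewrite lee_fin. Qed.

Let nu_sigma_additive : semi_sigma_additive nu.
Proof.
move=> F mF tF mUF; rewrite /density ge0_integral_bigcup //.
- apply: is_cvg_ereal_nneg_natsum => n _; exact: nu_ge0.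
- exact/measurable_EFinP/measurable_funTS.
- by move=> x _; rewrite lee_fin.
Qed.

HB.instance Definition _ := isMeasure.Build _ _ _ nu
  nu0 nu_ge0 nu_sigma_additive.

Import HBNNSimple.

(** Monotone convergence reduces the claim to simple functions, and linearity to indicators, for
    which it is the definition of [density]. *)
Lemma ge0_integral_density (D : set T) (f : T -> \bar R) :
  measurable D -> measurable_fun D f -> (forall x, D x -> 0 <= f x) ->
  \int[nu]_(x in D) f x = \int[mu]_(x in D) (f x * (w x)%:E).
Proof.
move=> mD mf f0; pose h := nnsfun_approx mD mf.
have mwD : measurable_fun D (fun x => (w x)%:E).
  exact/measurable_EFinP/measurable_funTS.
have -> : \int[nu]_(x in D) f x =
    lim (\int[nu]_(x in D) (EFin \o h n) x @[n --> \oo]).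
  have fE x : D x -> f x = lim ((EFin \o h n) x @[n --> \oo]).
    by move=> Dx; apply/esym/cvg_lim => //; exact: cvg_nnsfun_approx.
  under eq_integral => x /[!inE] /fE -> //.
  apply: monotone_convergence => //.
  - by move=> n; apply/measurable_EFinP/measurable_funTS.
  - by move=> n x Dx //=; rewrite lee_fin.
  - by move=> x Dx a b ab; rewrite lee_fin; exact/lefP/nd_nnsfun_approx.
have -> : \int[mu]_(x in D) (f x * (w x)%:E) =
    lim (\int[mu]_(x in D) ((EFin \o h n) x * (w x)%:E) @[n --> \oo]).
  have fg x : D x ->
      f x * (w x)%:E = lim (((EFin \o h n) x * (w x)%:E) @[n --> \oo]).
    move=> Dx; apply/esym/cvg_lim => //; apply: cvgeZr => //.
    exact: cvg_nnsfun_approx.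
  under eq_integral => x /[!inE] /fg -> //.
  apply: monotone_convergence => //.
  - move=> n; apply: emeasurable_funM => //.
    exact/measurable_EFinP/measurable_funTS.
  - by move=> n x Dx /=; rewrite mule_ge0 ?lee_fin.
  - move=> x Dx a b ab/=; rewrite lee_wpmul2r ?lee_fin //.
    exact/lefP/nd_nnsfun_approx.
(* Both sides are now limits along the same simple functions; each is split over its finite
   range. *)
congr (limn _); apply/funext => n /=.
transitivity (\int[nu]_(x in D)
   (\sum_(y \in range (h n)) (y * \1_(h n @^-1` [set y]) x)%:E)).
  by apply: eq_integral => t tD; rewrite /= fimfunE -fsumEFin.
rewrite ge0_integral_fsum//; last 2 first.
- by move=> y; apply/measurable_EFinP; exact: measurable_funM.
- by move=> y x Dx; exact: nnfun_muleindic_ge0.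
transitivity (\int[mu]_(x in D) (\sum_(y \in range (h n))
    ((y * \1_(h n @^-1` [set y]) x)%:E * (w x)%:E))); last first.
  apply: eq_integral => x xD.
  rewrite -ge0_mule_fsuml => [|y]; last exact: nnfun_muleindic_ge0.
  by rewrite fsumEFin // -(fimfunE _ x).
rewrite ge0_integral_fsum//; last 2 first.
- move=> y; apply: emeasurable_funM => //.
  by apply/measurable_EFinP; exact: measurable_funM.
- by move=> y x Dx; rewrite mule_ge0 ?lee_fin // -lee_fin nnfun_muleindic_ge0.
apply: eq_fsbigr => r rhn.
rewrite integralZl_indic_nnsfun => //.
under [RHS]eq_integral do rewrite EFinM -muleA.
have r0 : (0 <= r)%R by move: rhn; rewrite inE => -[t _ <-].
rewrite ge0_integralZl//; last 2 first.
- apply: emeasurable_funM => //; apply/measurable_EFinP/measurable_funTS.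
  exact: measurable_indic.
- by move=> t Dt; rewrite mule_ge0 ?lee_fin.
congr (_ * _); under [RHS]eq_integral do rewrite muleC.
rewrite integral_indic //= /density setIC integral_mkcondr.
by apply: eq_integral => x xD; rewrite epatch_indic.
Qed.

End Density.
Arguments density {d T R} mu {w} mw w0.

Section SquareSubstitution.
Context {R : realType}.
Local Notation mu := (@lebesgue_measure R).

Lemma integral_double_itv (a b : R) : 0 <= a -> a <= b ->
  (\int[mu]_(x in `]a, b]) (2 * x)%:E = (b ^+ 2 - a ^+ 2)%:E)%E.
Proof.
move=> a0; rewrite le_eqVlt => /predU1P[<-|ab].
  by rewrite set_itv_ge ?bnd_simp ?ltxx // integral_set0 subrr.
have dsq (x : R) : is_derive x 1 (fun x : R => x ^+ 2) (2 * x).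
  rewrite (_ : (fun x : R => _) = (id : R -> R) * id); last first.
    by apply/funext => y; rewrite expr2.
  by apply: is_derive_eq; rewrite /GRing.scale /= mulr1 mulr_natl mulr2n.
have csq : continuous (fun x : R => x ^+ 2).
  by move=> x; exact: exprn_continuous.
rewrite integral_itv_obnd_cbnd; last first.
  by apply/measurable_EFinP; apply: measurable_funTS; exact: measurable_funM.
rewrite (@continuous_FTC2 _ (fun x => 2 * x) (fun x : R => x ^+ 2)) //.
- apply: continuous_subspaceT => x; exact: mulrl_continuous.
- split => [x xab| |].
  + by apply: ex_derive.
  + by apply: cvg_at_right_filter; exact: csq.
  + by apply: cvg_at_left_filter; exact: csq.
- by move=> x xab; rewrite derive1E derive_val.
Qed.

(** The Jacobian of squaring, cut off on the negative half-line so that each [y > 0] is reached from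
    one square root only. *)
Definition double_pos (x : R) : R := 2 * Num.max x 0.

Lemma measurable_double_pos : measurable_fun setT double_pos.
Proof. by apply: measurable_funM => //; exact: measurable_maxr. Qed.

Lemma double_pos_ge0 x : 0 <= double_pos x.
Proof. by rewrite mulr_ge0 // le_max lexx orbT. Qed.

Let sqr (x : R) : measurableTypeR R := x ^+ 2.

Let msqr : measurable_fun setT sqr.
Proof. exact: exprn_measurable. Qed.

Let negative_half : set (measurableTypeR R) := `]-oo, 0].

Let mneg : measurable negative_half. Proof. exact: measurable_itv. Qed.

Let dens : {measure set (measurableTypeR R) -> \bar R} :=
  density (mu : {measure set (measurableTypeR R) -> \bar R})
    measurable_double_pos double_pos_ge0.

(** On an interval this is the fundamental theorem of calculus: [2x] has mass [b - a] between
    [sqrt a] and [sqrt b]. *)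
Lemma lebesgue_measure_sqr (A : set R) : measurable A ->
  A `<=` `]0, +oo[ -> mu A = pushforward dens sqr A.
Proof.
move=> mA A0.
(* The second summand extends the pushforward to a measure on the whole line,
   where Lebesgue measure is determined by its values on intervals. *)
pose nu := measure_add (pushforward dens sqr) (mrestr mu mneg).
have nuE (B : set (measurableTypeR R)) :
    nu msqr B = (pushforward dens sqr B + mu (B `&` negative_half))%E.
  by rewrite /nu /measure_add /msum !big_ord_recl big_ord0 adde0.
have -> : mu A = nu msqr A.
  apply: lebesgue_measure_unique => // _ [[a b] _ <-] /=.
  rewrite -[RHS]/(nu msqr _) nuE /pushforward.
  have [ba|ab] := leP b a.
    rewrite set_itv_ge; last by rewrite bnd_simp -leNgt.
    by rewrite preimage_set0 set0I !measure0 adde0.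
  have sab : Num.sqrt a <= Num.sqrt b by rewrite ler_wsqrtr // ltW.
  (* [Num.sqrt] is zero at negative arguments, so this formula also covers intervals that meet the
     negative half-line. *)
  have densE : dens (sqr @^-1` `]a, b]) =
      (Num.sqrt b ^+ 2 - Num.sqrt a ^+ 2)%:E.
    rewrite -(integral_double_itv _ _ (sqrtr_ge0 a) sab).
    transitivity (\int[mu]_(x in sqr @^-1` `]a, b]) (double_pos x)%:E)%E.
      by [].
    rewrite integral_mkcond [RHS]integral_mkcond; apply: eq_integral => x _.
    rewrite /patch.
    have -> : (x \in (`]Num.sqrt a, Num.sqrt b] : set R)) =
        (Num.sqrt a < x <= Num.sqrt b).
      by apply/idP/idP; rewrite inE /= in_itv.
    have -> : (x \in sqr @^-1` `]a, b]) = (a < x ^+ 2 <= b).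
      by apply/idP/idP; rewrite inE /= in_itv.
    have [x0|x0] := leP x 0.
      rewrite [Num.sqrt a < x]ltNge (le_trans x0 (sqrtr_ge0 a)) /=.
      by rewrite /double_pos (max_idPr x0) mulr0 if_same.
    rewrite /double_pos (max_idPl (ltW x0)).
    have sqrtE (c : R) : (c < x ^+ 2) = (Num.sqrt c < x).
      rewrite -{2}(gtr0_norm x0) -sqrtr_sqr ltr_sqrt //.
      by rewrite exprn_gt0.
    by rewrite /sqr sqrtE leNgt sqrtE -leNgt.
  have -> : `]a, b] `&` negative_half = `]Num.min a 0, Num.min b 0].
    apply/seteqP; split => x; rewrite /negative_half /= !in_itv /=.
      by move=> [/andP[ax xb] x0]; rewrite gt_min ax /= le_min xb.
    rewrite gt_min le_min => /andP[+ /andP[xb x0]].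
    by rewrite [0 < x]ltNge x0 orbF xb => ->.
  rewrite densE !lebesgue_measure_itv /= !lte_fin ab.
  (* The total becomes [max b 0 - max a 0] plus [min b 0 - min a 0], which is [b - a]. *)
  have sqrE (c : R) : Num.sqrt c ^+ 2 = Num.max c 0.
    have [c0|/ltW c0] := leP c 0; first by rewrite ler0_sqrtr // expr0n.
    by rewrite sqr_sqrtr.
  rewrite !sqrE.
  case: ifPn => [_|ab0]; rewrite ?adde0 -?EFinD; congr EFin.
    by case: (leP a 0) => a0; case: (leP b 0) => b0; lra.
  move: ab0; rewrite -leNgt.
  by case: (leP a 0) => a0; case: (leP b 0) => b0; lra.
rewrite nuE (_ : A `&` negative_half = set0) ?measure0 ?adde0 //.
rewrite -subset0 => x [/A0]; rewrite /negative_half /= !in_itv /= andbT => x0.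
by rewrite leNgt x0.
Qed.

(** Lebesgue measure on the positive half-line is replaced by the pushforward under squaring, which
    is then unfolded to the density [2x]. *)
Lemma ge0_integral_sqrt (phi : R -> \bar R) : measurable_fun setT phi ->
  (forall x, 0 <= phi x)%E ->
  (\int[mu]_(y in `]0%R, +oo[) phi (Num.sqrt y) =
   \int[mu]_(x in `]0%R, +oo[) (phi x * (2 * x)%R%:E))%E.
Proof.
move=> mphi phi0; pose D : set (measurableTypeR R) := `]0%R, +oo[.
have mD : measurable D by exact: measurable_itv.
have msqrt : measurable_fun setT (fun y : R => phi (Num.sqrt y)).
  apply: measurableT_comp => //; apply: continuous_measurable_fun.
  exact: sqrt_continuous.
transitivity (\int[pushforward dens sqr]_(y in D) phi (Num.sqrt y))%E.
  by apply: (eq_measure_integral (pushforward dens sqr)) => A mA AD;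
    apply: lebesgue_measure_sqr.
rewrite ge0_integral_pushforward //; last exact: measurable_funTS.
have msD : measurable (sqr @^-1` D : set R).
  by have := msqr measurableT D mD; rewrite setTI.
rewrite ge0_integral_density //; last 2 first.
- by apply: measurable_funTS; exact: measurableT_comp.
- by move=> x _; exact: phi0.
transitivity (\int[mu]_(x in sqr @^-1` D)
    (phi (Num.sqrt (sqr x)) * (double_pos x)%:E))%E; first by [].
(* The preimage of [D] also contains the negative [x], where [double_pos] vanishes. *)
rewrite integral_mkcond [RHS]integral_mkcond; apply: eq_integral => x _.
rewrite /patch.
have -> : (x \in (`]0, +oo[ : set R)) = (0 < x).
  by apply/idP/idP; rewrite inE /= in_itv /= andbT.
have -> : (x \in sqr @^-1` D) = (0 < x ^+ 2).
  by apply/idP/idP; rewrite inE /D /= in_itv /= andbT.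
have [x0|x0] := leP x 0.
  by rewrite /double_pos (max_idPr x0) mulr0 mule0 if_same.
by rewrite exprn_gt0 // /double_pos (max_idPl (ltW x0)) /sqr sqrtr_sqr gtr0_norm.
Qed.

(** The nonnegative case is applied to the positive and negative parts; the factor [2x] is
    nonnegative on the half-line and so commutes with taking them. *)
Lemma Rintegral_sqrt (phi : R -> R) : measurable_fun setT phi ->
  Rintegral mu `]0, +oo[ (fun y => phi (Num.sqrt y)) =
  Rintegral mu `]0, +oo[ (fun x => phi x * (2 * x)).
Proof.
move=> mphi; congr fine; rewrite integralE [RHS]integralE.
have mphiE : measurable_fun setT (EFin \o phi) by exact/measurable_EFinP.
congr (_ - _)%E.
- transitivity (\int[mu]_(y in `]0%R, +oo[) ((EFin \o phi)^\+%E (Num.sqrt y)))%E.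
    by apply: eq_integral => x _; rewrite ?funeposE ?funenegE.
  rewrite (ge0_integral_sqrt (EFin \o phi)^\+%E) //; last exact: measurable_funepos.
  apply: eq_integral => x; rewrite inE /= in_itv /= andbT => x0.
  rewrite !funeposE /= -!EFin_max -EFinM maxr_pMl ?mul0r //.
  by rewrite mulr_ge0 // ltW.
- transitivity (\int[mu]_(y in `]0%R, +oo[) ((EFin \o phi)^\-%E (Num.sqrt y)))%E.
    by apply: eq_integral => x _; rewrite ?funeposE ?funenegE.
  rewrite (ge0_integral_sqrt (EFin \o phi)^\-%E) //; last exact: measurable_funeneg.
  apply: eq_integral => x; rewrite inE /= in_itv /= andbT => x0.
  rewrite !funenegE /= -!EFin_max -EFinM maxr_pMl ?mul0r ?mulNr //.
  by rewrite mulr_ge0 // ltW.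
Qed.

Lemma Rintegral_oppr (D : set R) (f : R -> R) : measurable D ->
  measurable_fun setT f ->
  mu.-integrable (-%R @^-1` D) (EFin \o (fun x => f (- x))) ->
  Rintegral mu D f = Rintegral mu (-%R @^-1` D) (fun x => f (- x)).
Proof.
move=> mD mf intf; congr fine.
transitivity (\int[pushforward mu (-%R : _ -> measurableTypeR R)]_(x in D)
    (f x)%:E)%E.
  by apply: eq_measure_integral => /= A mA AD; rewrite lebesgue_measureN.
have mN : measurable_fun setT (-%R : R -> measurableTypeR R) by [].
apply: (@integral_pushforward _ _ (measurableTypeR R) (measurableTypeR R) R
  _ mN mu D (EFin \o f)) => //.
exact/measurable_EFinP.
Qed.

Lemma Rintegral_odd (f : R -> R) : mu.-integrable setT (EFin \o f) ->
  (forall x, f (- x) = - f x) -> Rintegral mu setT f = 0.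
Proof.
move=> fi fN; have mf : measurable_fun setT f.
  by apply/measurable_EFinP; exact: (measurable_int mu).
have fE : (fun x => f (- x)) = (fun x => -1 * f x).
  by apply/funext => x; rewrite fN mulN1r.
have := Rintegral_oppr setT f measurableT mf.
rewrite fE preimage_setT RintegralZl // => fi'; suff : Rintegral mu setT f =
  -1 * Rintegral mu setT f by lra.
apply: fi'; have := integrableZl measurableT (-1) fi.
by apply: eq_integrable => // x _ /=; rewrite EFinM.
Qed.

Lemma Rintegral_even (f : R -> R) : mu.-integrable setT (EFin \o f) ->
  (forall x, f (- x) = f x) ->
  Rintegral mu setT f = 2 * Rintegral mu `]0, +oo[ f.
Proof.
move=> fi fE; have mf : measurable_fun setT f.
  by apply/measurable_EFinP; exact: (measurable_int mu).
have fiS (D : set R) : measurable D -> mu.-integrable D (EFin \o f).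
  by move=> mD; apply: integrableS fi.
have NE : -%R @^-1` `]0%R, +oo[ = `]-oo, 0%R[ :> set R.
  by rewrite opp_preimage_itvbndy oppr0.
have {}fE : (fun x => f (- x)) = f by apply/funext.
have := Rintegral_oppr `]0, +oo[ f (measurable_itv _) mf.
rewrite NE fE => /(_ (fiS _ (measurable_itv _))) nE.
rewrite -(setUv `]-oo, 0[) Rintegral_setU //; last 3 first.
- exact: measurableC.
- by rewrite setUv.
- exact/disj_setPCl.
rewrite setCitvl -nE -Rintegral_itv_obnd_cbnd ?fiS //; first by ring.
Qed.

End SquareSubstitution.

(** * Complex and matrix-valued integrals *)

Section ComplexIntegral.
Context {R : realType}.
Local Notation mu := (@lebesgue_measure R).
Local Notation C := R[i].
Implicit Types (A : set (measurableTypeR R)) (f g : R -> C).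

Lemma Re_complexM (a b : C) : complex.Re (a * b) =
  complex.Re a * complex.Re b - complex.Im a * complex.Im b.
Proof. by case: a b => [a b] [c d]. Qed.

Lemma Im_complexM (a b : C) : complex.Im (a * b) =
  complex.Re a * complex.Im b + complex.Im a * complex.Re b.
Proof. by case: a b => [a b] [c d]. Qed.

Lemma Re_complexD (a b : C) : complex.Re (a + b) = complex.Re a + complex.Re b.
Proof. by case: a b => [a b] [c d]. Qed.

Lemma Im_complexD (a b : C) : complex.Im (a + b) = complex.Im a + complex.Im b.
Proof. by case: a b => [a b] [c d]. Qed.

Lemma complex_eq (a b : C) :
  complex.Re a = complex.Re b -> complex.Im a = complex.Im b -> a = b.
Proof. by case: a b => [a b] [c d] /= -> ->. Qed.

Lemma integrableDR {A : set (measurableTypeR R)} {f g : R -> R} :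
  measurable A ->
  mu.-integrable A (EFin \o f) -> mu.-integrable A (EFin \o g) ->
  mu.-integrable A (EFin \o (fun x => f x + g x)).
Proof.
move=> mA fi gi; have := integrableD mA fi gi.
by apply: eq_integrable => // x _ /=; rewrite EFinD.
Qed.

Lemma integrableZR {A : set (measurableTypeR R)} (c : R) {f : R -> R} :
  measurable A ->
  mu.-integrable A (EFin \o f) -> mu.-integrable A (EFin \o (fun x => c * f x)).
Proof.
move=> mA fi; have := integrableZl mA c fi.
by apply: eq_integrable => // x _ /=; rewrite EFinM.
Qed.

Lemma Cintegrable0 A : measurable A -> Cintegrable A (fun=> 0).
Proof. by move=> mA; split; apply: integrable0. Qed.

Lemma CintegrableD A f g : measurable A ->
  Cintegrable A f -> Cintegrable A g -> Cintegrable A (fun x => f x + g x).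
Proof.
move=> mA [f1 f2] [g1 g2]; split.
  have := integrableDR mA f1 g1.
  by apply: eq_integrable => // x _ /=; rewrite Re_complexD.
have := integrableDR mA f2 g2.
by apply: eq_integrable => // x _ /=; rewrite Im_complexD.
Qed.

Lemma CintegrableZ A f c : measurable A ->
  Cintegrable A f -> Cintegrable A (fun x => c * f x).
Proof.
move=> mA [f1 f2]; split.
  have := integrableDR mA (integrableZR (complex.Re c) mA f1)
    (integrableZR (- complex.Im c) mA f2).
  by apply: eq_integrable => // x _ /=; rewrite Re_complexM mulNr.
have := integrableDR mA (integrableZR (complex.Re c) mA f2)
    (integrableZR (complex.Im c) mA f1).
by apply: eq_integrable => // x _ /=; rewrite Im_complexM.
Qed.

Lemma Cintegrable_sum A (I : Type) (s : seq I) (F : I -> R -> C) :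
  measurable A -> (forall i, Cintegrable A (F i)) ->
  Cintegrable A (fun x => \sum_(i <- s) F i x).
Proof.
move=> mA Fi; elim: s => [|i s IH].
  rewrite (_ : (fun _ => _) = (fun=> 0)); first exact: Cintegrable0.
  by apply/funext => x; rewrite big_nil.
rewrite (_ : (fun _ => _) = (fun x => F i x + \sum_(j <- s) F j x)).
  exact: CintegrableD.
by apply/funext => x; rewrite big_cons.
Qed.

Lemma CintD A f g : measurable A -> Cintegrable A f -> Cintegrable A g ->
  Cint A (fun x => f x + g x) = Cint A f + Cint A g.
Proof.
move=> mA [f1 f2] [g1 g2]; apply: complex_eq.
  by rewrite Re_complexD /= -RintegralD //; apply: eq_Rintegral => x _; rewrite Re_complexD.
by rewrite Im_complexD /= -RintegralD //; apply: eq_Rintegral => x _; rewrite Im_complexD.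
Qed.

Lemma CintZ A f c : measurable A -> Cintegrable A f ->
  Cint A (fun x => c * f x) = c * Cint A f.
Proof.
move=> mA [f1 f2]; apply: complex_eq.
  rewrite Re_complexM /= -mulNr -!RintegralZl // -RintegralD //; try exact: integrableZR.
  by apply: eq_Rintegral => x _; rewrite Re_complexM mulNr.
rewrite Im_complexM /= -!RintegralZl // -RintegralD //; try exact: integrableZR.
by apply: eq_Rintegral => x _; rewrite Im_complexM.
Qed.

Lemma Cint0 A : Cint A (fun=> 0) = 0.
Proof. by apply: complex_eq; rewrite /= /Rintegral integral0. Qed.

Lemma Cint_sum A (I : Type) (s : seq I) (F : I -> R -> C) : measurable A ->
  (forall i, Cintegrable A (F i)) ->
  Cint A (fun x => \sum_(i <- s) F i x) = \sum_(i <- s) Cint A (F i).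
Proof.
move=> mA Fi; elim: s => [|i s IH].
  rewrite big_nil -[RHS](Cint0 A); congr Cint.
  by apply/funext => x; rewrite big_nil.
rewrite big_cons -IH -CintD //; last exact: Cintegrable_sum.
by congr Cint; apply/funext => x; rewrite big_cons.
Qed.

Lemma Re_complexJ (a : C) : complex.Re (Num.conj a) = complex.Re a.
Proof. by case: a. Qed.

Lemma Im_complexJ (a : C) : complex.Im (Num.conj a) = - complex.Im a.
Proof. by case: a. Qed.

Lemma Cint_conj A f : measurable A -> Cintegrable A f ->
  Cint A (fun x => Num.conj (f x)) = Num.conj (Cint A f).
Proof.
move=> mA [f1 f2]; apply: complex_eq.
  by rewrite Re_complexJ; apply: eq_Rintegral => x _; rewrite Re_complexJ.
rewrite Im_complexJ /= -[RHS]mulN1r -RintegralZl //.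
by apply: eq_Rintegral => x _; rewrite Im_complexJ mulN1r.
Qed.

Lemma lebesgue_aeS (P Q : R -> Prop) : (forall x, P x -> Q x) ->
  {ae mu, forall x, P x} -> {ae mu, forall x, Q x}.
Proof.
by move=> PQ; apply: (@filterS _ _ (ae_filter_ringOfSetsType mu)).
Qed.

Lemma lebesgue_aeS2 (P Q S : R -> Prop) : (forall x, P x -> Q x -> S x) ->
  {ae mu, forall x, P x} -> {ae mu, forall x, Q x} -> {ae mu, forall x, S x}.
Proof.
by move=> PQ; apply: (@filterS2 _ _ (ae_filter_ringOfSetsType mu)).
Qed.

Lemma Rintegral_ae_eq A (f g : R -> R) : measurable A ->
  mu.-integrable A (EFin \o f) -> mu.-integrable A (EFin \o g) ->
  {ae mu, forall x, A x -> f x = g x} ->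
  Rintegral mu A f = Rintegral mu A g.
Proof.
move=> mA fi gi fg; congr fine; apply: ae_eq_integral => //.
- exact: measurable_int fi.
- exact: measurable_int gi.
- by apply: lebesgue_aeS fg => x h Ax /=; rewrite h.
Qed.

Lemma Cint_ae_eq A f g : measurable A -> Cintegrable A f -> Cintegrable A g ->
  {ae mu, forall x, A x -> f x = g x} -> Cint A f = Cint A g.
Proof.
move=> mA [f1 f2] [g1 g2] fg; apply: complex_eq.
  apply: Rintegral_ae_eq mA f1 g1 _.
  by apply: lebesgue_aeS fg => x h Ax /=; rewrite h.
apply: Rintegral_ae_eq mA f2 g2 _.
by apply: lebesgue_aeS fg => x h Ax /=; rewrite h.
Qed.

Lemma Rintegral_gt0_neq0 (f : R -> R) : mu.-integrable setT (EFin \o f) ->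
  {ae mu, forall x, 0 < f x} -> Rintegral mu setT f <> 0.
Proof.
move=> fi f0 I0; have mf := measurable_int _ fi.
have fin : (\int[mu]_x (f x)%:E \is a fin_num)%E := integrable_fin_num measurableT fi.
have I0' : (\int[mu]_x `|(f x)%:E| = 0)%E.
  rewrite -[RHS](_ : \int[mu]_x (f x)%:E = 0)%E; last first.
    by rewrite -[LHS]fineK // -[fine _]/(Rintegral mu setT f) I0.
  apply: ae_eq_integral => //; first exact: measurableT_comp.
  by apply: lebesgue_aeS f0 => x fx _; rewrite gee0_abs // lee_fin ltW.
have ae0 : {ae mu, forall x, setT x -> (f x)%:E = 0%E}.
  by apply/(ae_eq_integral_abs mu measurableT mf).
have : {ae mu, forall x : R, False}.
  apply: lebesgue_aeS2 f0 ae0 => x fx /(_ Logic.I)[fx0].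
  by rewrite fx0 ltxx in fx.
(* A property that never holds can hold almost everywhere only if the whole line is null. *)
move=> [N [mN N0 sN]].
have : (mu setT <= mu N)%E.
  by apply: le_measure; rewrite ?inE // => x _; apply: sN => /=.
by rewrite N0 -set_itvNyy lebesgue_measure_itv.
Qed.

End ComplexIntegral.

(** * Evaluation of matrix polynomials at real points, and positive definite matrices *)

Section MatrixEvaluation.
Context {R : realType} {n : nat}.
Local Notation M := 'M[R[i]]_n.+1.

HB.instance Definition _ := GRing.RMorphism.copy (@Cx R) (@real_complex R).

Lemma CxX (x : R) k : Cx (x ^+ k) = Cx x ^+ k.
Proof. exact: rmorphXn. Qed.

Lemma CxM (x y : R) : Cx (x * y) = Cx x * Cx y.
Proof. exact: rmorphM. Qed.

Lemma conj_Cx (x : R) : Num.conj (Cx x) = Cx x.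
Proof. by apply: complex_eq; rewrite ?Re_complexJ ?Im_complexJ //= oppr0. Qed.

Lemma cmx_comm (x : R) (A : M) : A * cmx x = cmx x * A.
Proof. by rewrite -mulmxE scalar_mxC. Qed.

(** Real points enter as scalar matrices, which are central. *)
Lemma horner_cmxM (P Q : {poly M}) x :
  (P * Q).[cmx x] = P.[cmx x] * Q.[cmx x].
Proof. by rewrite hornerM_comm // /comm_poly cmx_comm. Qed.

Lemma horner_cmx_comp_sqr (P : {poly M}) x :
  (P \Po 'X^2).[cmx x] = P.[cmx (x ^+ 2)].
Proof.
elim/poly_ind: P => [|P c IH]; first by rewrite comp_poly0 !horner0.
rewrite comp_poly_MXaddC !hornerD !hornerC !horner_cmxM IH !hornerX.
by rewrite /cmx CxX expr2 rmorphM.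
Qed.

Lemma horner_cmx_entry (P : {poly M}) x i j :
  P.[cmx x] i j = \sum_(k < size P) P`_k i j * Cx (x ^+ k).
Proof.
rewrite horner_coef summxE; apply: eq_bigr => k _.
by rewrite -[cmx x ^+ k]rmorphXn -CxX -mulmxE mul_mx_scalar mxE mulrC.
Qed.

Lemma addmx_entry m p (A B : 'M[R[i]]_(m, p)) i j : (A + B) i j = A i j + B i j.
Proof. by rewrite mxE. Qed.

Lemma mulmx_entry m p q (A : 'M[R[i]]_(m, p)) (B : 'M[R[i]]_(p, q)) i j :
  (A *m B) i j = \sum_k A i k * B k j.
Proof. by rewrite mxE. Qed.

Lemma mx_ctransE m p (A : 'M[R[i]]_(m, p)) i j :
  mx_ctrans A i j = Num.conj (A j i).
Proof. by rewrite !mxE. Qed.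

Lemma mx_ctransM m p q (A : 'M[R[i]]_(m, p)) (B : 'M[R[i]]_(p, q)) :
  mx_ctrans (A *m B) = mx_ctrans B *m mx_ctrans A.
Proof. by rewrite /mx_ctrans trmx_mul map_mxM. Qed.

Lemma mx_ctransK m p (A : 'M[R[i]]_(m, p)) : mx_ctrans (mx_ctrans A) = A.
Proof. by apply/matrixP => i j; rewrite !mxE conjCK. Qed.

(** The order on [R[i]] relates only numbers with equal imaginary parts, so a positive value is
    real. *)
Lemma posdef_quad_real m (H : 'M[R[i]]_m) (v : 'rV[R[i]]_m) : posdef H ->
  complex.Im ((v *m H *m mx_ctrans v) 0 0) = 0.
Proof.
move=> pH; have [->|v0] := eqVneq v 0; first by rewrite !mul0mx mxE.
by have := pH _ v0; case: ((_ *m _) 0 0) => a b; rewrite ltcE /= => /andP[/eqP].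
Qed.

(** [posdef] speaks only of the quadratic form; since that form is real, polarization makes the
    matrix Hermitian. *)
Lemma posdef_ctrans m (H : 'M[R[i]]_m) : posdef H -> mx_ctrans H = H.
Proof.
move=> pH; apply/matrixP => i j; rewrite !mxE.
pose h (u v : 'rV[R[i]]_m) := (u *m H *m mx_ctrans v) 0 0.
have hE a b : h (delta_mx 0 a) (delta_mx 0 b) = H a b.
  rewrite /h /mx_ctrans trmx_delta map_delta_mx -rowE.
  by rewrite -colE !mxE.
(* Polarization at [e_i + c e_j], used for [c = 1] and [c = i]. *)
have hpol c : complex.Im (Num.conj c * H i j + c * H j i) = 0.
  have qE v : complex.Im (h v v) = 0 by exact: posdef_quad_real.
  have hDl u u' v : h (u + u') v = h u v + h u' v by rewrite /h !mulmxDl mxE.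
  have hDr u v v' : h u (v + v') = h u v + h u v'.
    by rewrite /h /mx_ctrans raddfD map_mxD mulmxDr mxE.
  have hZl u v : h (c *: u) v = c * h u v by rewrite /h -!scalemxAl mxE.
  have hZr u v : h u (c *: v) = Num.conj c * h u v.
    by rewrite /h /mx_ctrans linearZ map_mxZ -scalemxAr mxE.
  have := qE (delta_mx 0 i + c *: delta_mx 0 j).
  have := qE (delta_mx 0 i); have := qE (c *: delta_mx 0 j).
  by rewrite !(hDl, hDr, hZl, hZr, hE) ?mulrDr !Im_complexD; lra.
have h1 := hpol 1; have h2 := hpol 'i%C.
rewrite rmorph1 !mul1r Im_complexD in h1.
rewrite Im_complexD !Im_complexM Re_complexJ Im_complexJ /= in h2.
apply: complex_eq; rewrite ?Re_complexJ ?Im_complexJ; lra.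
Qed.

End MatrixEvaluation.

(** * The matrix-valued inner product of a weight *)

Section WeightForm.
Context {R : realType} {n : nat} (W : R -> 'M[R[i]]_n.+1).
Hypothesis hW : is_weight [set: R] W.
Local Notation M := 'M[R[i]]_n.+1.
Local Notation mu := (@lebesgue_measure R).
Implicit Types (P Q : {poly M}).

Definition ip_integrand P Q x : M := P.[cmx x] *m W x *m mx_ctrans Q.[cmx x].

(** Written this way the entries are combinations of [x^k W_ab(x)], whose integrability is the
    finite moment condition. *)
Lemma ip_integrandE P Q i j x : ip_integrand P Q x i j =
  \sum_b \sum_a \sum_(l < size Q) \sum_(k < size P)
    (P`_k i a * Num.conj (Q`_l j b)) * (Cx (x ^+ (k + l)) * W x a b).
Proof.
rewrite /ip_integrand mxE; apply: eq_bigr => b _; rewrite mxE big_distrl.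
apply: eq_bigr => a _; rewrite !mxE !horner_cmx_entry rmorph_sum big_distrr.
apply: eq_bigr => l _; rewrite rmorphM /= conj_Cx !big_distrl.
apply: eq_bigr => k _; rewrite /= exprD CxM.
ring.
Qed.

Lemma ip_integrable P Q i j :
  Cintegrable [set: R] (fun x => ip_integrand P Q x i j).
Proof.
have [_ _ _ Wm] := hW.
rewrite (_ : (fun _ => _) =
  (fun x => \sum_b \sum_a \sum_(l < size Q) \sum_(k < size P)
    (P`_k i a * Num.conj (Q`_l j b)) * (Cx (x ^+ (k + l)) * W x a b))).
  by do 4 (apply: Cintegrable_sum => // ?); exact: CintegrableZ.
by apply/funext => x; exact: ip_integrandE.
Qed.

Lemma ip_entry P Q i j :
  ip [set: R] W P Q i j = Cint [set: R] (fun x => ip_integrand P Q x i j).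
Proof. by rewrite mxE. Qed.

Lemma ipD P P' Q :
  ip [set: R] W (P + P') Q = ip [set: R] W P Q + ip [set: R] W P' Q.
Proof.
apply/matrixP => i j; rewrite addmx_entry.
rewrite [LHS]ip_entry [X in _ = X + _]ip_entry [X in _ = _ + X]ip_entry.
rewrite -[RHS](CintD _ _ _ _ (ip_integrable P Q i j) (ip_integrable P' Q i j)) //.
congr Cint; apply/funext => x.
by rewrite /ip_integrand hornerD !mulmxDl addmx_entry.
Qed.

Lemma ipZ c P Q : ip [set: R] W (c%:P * P) Q = c * ip [set: R] W P Q.
Proof.
apply/matrixP => i j; rewrite -mulmxE mulmx_entry.
rewrite [LHS]ip_entry.
transitivity (Cint [set: R] (fun x => \sum_k c i k * ip_integrand P Q x k j)).
  congr Cint; apply/funext => x.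
  by rewrite /ip_integrand hornerCM -mulmxE -!mulmxA mulmx_entry.
rewrite Cint_sum //; last by move=> k; apply: CintegrableZ => //; exact: ip_integrable.
apply: eq_bigr => k _; rewrite [X in _ = _ * X]ip_entry.
by apply: CintZ => //; exact: ip_integrable.
Qed.

(** [W x] is positive definite, hence Hermitian, for almost every [x], and the integral ignores the
    exceptional null set. *)
Lemma ip_ctrans P Q : ip [set: R] W Q P = mx_ctrans (ip [set: R] W P Q).
Proof.
have [_ Wp _ _] := hW.
apply/matrixP => i j; rewrite mx_ctransE.
rewrite [LHS]ip_entry [X in Num.conj X]ip_entry.
rewrite -[RHS](Cint_conj _ _ _ (ip_integrable P Q j i)) //.
apply: Cint_ae_eq => //; first exact: ip_integrable.
  have [h1 h2] := ip_integrable P Q j i; split.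
    by apply: eq_integrable h1 => // x _ /=; rewrite Re_complexJ.
  have := integrableZR (-1) measurableT h2.
  by apply: eq_integrable => // x _ /=; rewrite Im_complexJ mulN1r.
apply: lebesgue_aeS Wp => x /(_ Logic.I) /posdef_ctrans Wx _.
rewrite /ip_integrand -[in LHS]Wx.
rewrite (_ : _ *m mx_ctrans P.[cmx x] = mx_ctrans (ip_integrand P Q x)) ?mxE //.
by rewrite /ip_integrand !mx_ctransM mx_ctransK mulmxA.
Qed.

Lemma ip_eq0C P Q : ip [set: R] W P Q = 0 -> ip [set: R] W Q P = 0.
Proof.
move=> PQ0; rewrite ip_ctrans PQ0.
by apply/matrixP => i j; rewrite !mxE rmorph0.
Qed.

Lemma ae_horner_neq0 (p : {poly R[i]}) : p != 0 ->
  {ae mu, forall x, p.[Cx x] != 0}.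
Proof.
move=> p0; have [r pE] := closed_field_poly_normal p.
have lp0 : lead_coef p != 0 by rewrite lead_coef_eq0.
(* A real zero of [p] equals its own real part, so all of them lie in this finite set. *)
pose A : set R := [set` [seq complex.Re z | z <- r]].
have cA : countable A by apply: finite_set_countable; exact: finite_seq.
exists A; split; first exact: countable_measurable.
  exact: countable_lebesgue_measure0.
move=> x /= /negP; rewrite negbK pE hornerZ mulf_eq0 (negbTE lp0) /=.
rewrite -/(root _ _) root_prod_XsubC => xr.
by rewrite /A /=; apply/mapP; exists (Cx x).
Qed.

(** If a row [v] annihilated the Gram matrix, the integral of the quadratic form of [W] at [v P(x)]
    would be zero. As [P] is monic, [v P(x)] is nonzero for almost every [x], so this integrand is
    positive almost everywhere. *)
Lemma ip_monic_unit P : P \is monic -> ip [set: R] W P P \is a GRing.unit.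
Proof.
move=> Pm; have [_ Wp _ _] := hW.
rewrite -[_ \is a _]/(_ \in unitmx) unitmxE unitfE.
apply/negP => /det0P[v v0 vG0].
pose g x := (v *m ip_integrand P P x *m mx_ctrans v) 0 0.
pose vv b a := v 0 a * Num.conj (v 0 b).
have gE : g = fun x => \sum_b \sum_a vv b a * ip_integrand P P x a b.
  apply/funext => x.
  rewrite /g mxE; apply: eq_bigr => b _; rewrite mxE big_distrl.
  by apply: eq_bigr => a _; rewrite !mxE mulrAC.
have gi : Cintegrable [set: R] g.
  rewrite gE; do 2 (apply: Cintegrable_sum => // ?).
  by apply: CintegrableZ => //; exact: ip_integrable.
have g0 : Cint [set: R] g = 0.
  transitivity ((v *m ip [set: R] W P P *m mx_ctrans v) 0 0); last first.
    by rewrite vG0 mul0mx mxE.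
  rewrite gE Cint_sum // => [|b]; last first.
    apply: Cintegrable_sum => // ?.
    by apply: CintegrableZ => //; exact: ip_integrable.
  rewrite mulmx_entry; apply: eq_bigr => b _.
  rewrite [LHS]Cint_sum // => [|a]; last first.
    by apply: CintegrableZ => //; exact: ip_integrable.
  rewrite mulmx_entry big_distrl; apply: eq_bigr => a _.
  rewrite [LHS](CintZ _ _ _ _ (ip_integrable P P a b)) // mx_ctransE.
  by rewrite /= [RHS]mulrAC [X in _ = _ * X]ip_entry.
have [j vj] : exists j, v 0 j != 0.
  apply/existsP; rewrite -negb_forall; apply: contra v0 => /forallP v00.
  by apply/eqP/rowP => j; rewrite mxE; apply/eqP.
(* Coordinate [j] of [v P] as a scalar polynomial; its leading coefficient is [v 0 j] because [P] is
   monic. *)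
pose p : {poly R[i]} := \poly_(k < size P) (v *m P`_k) 0 j.
have p0 : p != 0.
  apply/eqP => /polyP/(_ (size P).-1); rewrite coef_poly coef0.
  rewrite prednK ?leqnn; last by rewrite lt0n size_poly_eq0 monic_neq0.
  by move/monicP: Pm; rewrite lead_coefE => ->; rewrite mulmx1; apply/eqP.
have pE x : (v *m P.[cmx x]) 0 j = p.[Cx x].
  rewrite horner_poly mxE.
  under eq_bigr do rewrite horner_cmx_entry big_distrr.
  rewrite exchange_big; apply: eq_bigr => k _ /=.
  by rewrite mxE big_distrl; apply: eq_bigr => a _; rewrite CxX mulrA.
have [gr _] := gi; apply: (Rintegral_gt0_neq0 _ gr); last first.
  by move/(congr1 (@complex.Re R)): g0.
apply: lebesgue_aeS2 Wp (ae_horner_neq0 p p0) => x /(_ Logic.I) Wx px.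
have u0 : v *m P.[cmx x] != 0.
  by apply: contra px => /eqP u0; rewrite -pE u0 mxE.
have := Wx _ u0; rewrite mx_ctransM !mulmxA.
rewrite (_ : _ 0 0 = g x); last by rewrite /g /ip_integrand !mulmxA.
by case: (g x) => a b; rewrite ltcE /= => /andP[].
Qed.

End WeightForm.

(** * Even weights: parity, interleaved orthogonal sequences, and the passage to the Laguerre-type
    weight *)

Section SymmetricWeight.
Context {R : realType} {n : nat} (W : R -> 'M[R[i]]_n.+1).
Hypothesis hW : is_weight [set: R] W.
Hypothesis hsym : forall x : R, W x = W (- x).
Local Notation M := 'M[R[i]]_n.+1.
Local Notation mu := (@lebesgue_measure R).
Implicit Types (P Q : {poly M}).

Lemma CxN (x : R) : Cx (- x) = - Cx x.
Proof. exact: rmorphN. Qed.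

Lemma horner_cmx_sqrX P x :
  ((P \Po 'X^2) * 'X).[cmx x] = Cx x *: P.[cmx (x ^+ 2)].
Proof.
by rewrite horner_cmxM hornerX horner_cmx_comp_sqr -mulmxE mul_mx_scalar.
Qed.

Lemma mx_ctransZ m p (c : R[i]) (A : 'M[R[i]]_(m, p)) :
  mx_ctrans (c *: A) = Num.conj c *: mx_ctrans A.
Proof. by rewrite /mx_ctrans linearZ map_mxZ. Qed.

Lemma Cint_odd (f : R -> R[i]) : Cintegrable [set: R] f ->
  (forall x, f (- x) = - f x) -> Cint [set: R] f = 0.
Proof.
move=> [f1 f2] fN; apply: complex_eq; apply: Rintegral_odd => // x; rewrite fN.
  by case: (f x).
by case: (f x).
Qed.

Definition sqr_integrand P Q x : M :=
  P.[cmx (x ^+ 2)] *m W x *m mx_ctrans Q.[cmx (x ^+ 2)].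

Lemma sqr_integrandN P Q x : sqr_integrand P Q (- x) = sqr_integrand P Q x.
Proof. by rewrite /sqr_integrand sqrrN -hsym. Qed.

Lemma ip_integrand_mixed P Q x :
  ip_integrand W (P \Po 'X^2) ((Q \Po 'X^2) * 'X) x =
  Cx x *: sqr_integrand P Q x.
Proof.
transitivity (P.[cmx (x ^+ 2)] *m W x *m mx_ctrans (Cx x *: Q.[cmx (x ^+ 2)])).
  congr (_ *m _ *m mx_ctrans _); first exact: horner_cmx_comp_sqr.
  exact: horner_cmx_sqrX.
by rewrite mx_ctransZ conj_Cx -scalemxAr.
Qed.

Lemma ip_integrand_odd P Q x :
  ip_integrand W ((P \Po 'X^2) * 'X) ((Q \Po 'X^2) * 'X) x =
  (Cx x * Cx x) *: sqr_integrand P Q x.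
Proof.
transitivity ((Cx x *: P.[cmx (x ^+ 2)]) *m W x *m
    mx_ctrans (Cx x *: Q.[cmx (x ^+ 2)])).
  congr (_ *m _ *m mx_ctrans _); exact: horner_cmx_sqrX.
by rewrite mx_ctransZ conj_Cx -scalemxAr -!scalemxAl scalerA.
Qed.

Lemma scalemx_entry m p (c : R[i]) (A : 'M[R[i]]_(m, p)) i j :
  (c *: A) i j = c * A i j.
Proof. by rewrite mxE. Qed.

Lemma ip_even_odd P Q : ip [set: R] W (P \Po 'X^2) ((Q \Po 'X^2) * 'X) = 0.
Proof.
apply/matrixP => i j; rewrite [RHS]mxE [LHS]ip_entry.
apply: Cint_odd => [|x]; first exact: ip_integrable.
rewrite [in LHS]ip_integrand_mixed [in RHS]ip_integrand_mixed sqr_integrandN.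
by rewrite CxN !scalemx_entry mulNr.
Qed.

Definition interleave (A Q : nat -> {poly M}) k :=
  if odd k then (Q k./2 \Po 'X^2) * 'X else A k./2 \Po 'X^2.

(** Members of opposite parity are orthogonal because [W] is even. Any orthogonal odd family is thus
    completed to a sequence to which [inD] applies. *)
Lemma interleave_OPS (A Q : nat -> {poly M}) :
  (forall k, A k \is monic /\ size (A k) = k.+1) ->
  (forall k, Q k \is monic /\ size (Q k) = k.+1) ->
  (forall k l, k <> l -> ip [set: R] W (A k \Po 'X^2) (A l \Po 'X^2) = 0) ->
  (forall k l, k <> l ->
    ip [set: R] W ((Q k \Po 'X^2) * 'X) ((Q l \Po 'X^2) * 'X) = 0) ->
  monic_OPS [set: R] W (interleave A Q).
Proof.
move=> Am Qm Ao Qo; split=> [k|k l kl].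
  have kE := odd_double_half k; rewrite /interleave.
  case ok: (odd k) kE => /= kE.
    have [m s] := Qm k./2; have [m2 ->] := monic_comp_sqrX _ _ _ m s.
    by rewrite -[in RHS]kE.
  have [m s] := Am k./2; have [m2 ->] := monic_comp_sqr _ _ _ m s.
  by rewrite -[in RHS]kE.
have half : odd k = odd l -> k./2 <> l./2.
  by move=> o h; apply: kl; rewrite -[k]odd_double_half o h odd_double_half.
rewrite /interleave; case ok: (odd k); case ol: (odd l).
- by apply/Qo/half; rewrite ok ol.
- exact/(ip_eq0C W hW)/ip_even_odd.
- exact: ip_even_odd.
- by apply/Ao/half; rewrite ok ol.
Qed.

Lemma size_monic_pred P : P \is monic -> size P = (size P).-1.+1.
Proof. by move=> Pm; rewrite prednK // lt0n size_poly_eq0 monic_neq0. Qed.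

Lemma exists_even_family : exists A : nat -> {poly M},
  (forall k, A k \is monic /\ size (A k) = k.+1) /\
  (forall k l, k <> l -> ip [set: R] W (A k \Po 'X^2) (A l \Po 'X^2) = 0).
Proof.
apply: (gram_schmidt _ (fun p q => ip [set: R] W (p \Po 'X^2) (q \Po 'X^2))).
- by move=> p q r; rewrite comp_polyD; exact: ipD.
- by move=> c p r; rewrite comp_sqrM comp_polyC; exact: ipZ.
- by move=> p q; exact: ip_eq0C.
- move=> p pm; apply: ip_monic_unit => //.
  by have [] := monic_comp_sqr _ p _ pm (size_monic_pred p pm).
Qed.

(** It yields the oddness of the operator coefficients, and with it the action on smooth functions,
    before any orthogonal sequence of the Laguerre-type weight is given. *)
Lemma exists_odd_family : exists A : nat -> {poly M},
  (forall k, A k \is monic /\ size (A k) = k.+1) /\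
  (forall k l, k <> l ->
    ip [set: R] W ((A k \Po 'X^2) * 'X) ((A l \Po 'X^2) * 'X) = 0).
Proof.
apply: (gram_schmidt _ (fun p q =>
  ip [set: R] W ((p \Po 'X^2) * 'X) ((q \Po 'X^2) * 'X))).
- by move=> p q r; rewrite comp_polyD mulrDl; exact: ipD.
- by move=> c p r; rewrite comp_sqrM comp_polyC -mulrA; exact: ipZ.
- by move=> p q; exact: ip_eq0C.
- move=> p pm; apply: ip_monic_unit => //.
  by have [] := monic_comp_sqrX _ p _ pm (size_monic_pred p pm).
Qed.

(** The substitution produces [2 x g(x)] on the half-line; the factor 2 is absorbed by passing to
    the whole line, as [x g(x)] is even. *)
Lemma Rintegral_sqr_subst (f g h : R -> R) :
  measurable_fun setT g -> mu.-integrable setT (EFin \o h) ->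
  (forall y, 0 < y -> f y = g (Num.sqrt y)) ->
  (forall x, h x = g x * x) -> (forall x, h (- x) = h x) ->
  Rintegral mu `]0, +oo[ f = Rintegral mu setT h.
Proof.
move=> mg hi fg hg hN.
rewrite (Rintegral_even h hi hN) -RintegralZl //; last exact: integrableS hi.
transitivity (Rintegral mu `]0, +oo[ (fun y => g (Num.sqrt y))).
  by apply: eq_Rintegral => y; rewrite inE /= in_itv /= andbT => /fg.
rewrite (Rintegral_sqrt _ mg); apply: eq_Rintegral => x _.
by rewrite hg; ring.
Qed.

Variable Z : R -> M.
Hypothesis hWZ : forall x : R, W x = Cx (expR (- x ^+ 2)) *: Z x.

(** At [y = x^2] with [x > 0] the associated weight is [x W(x)]. This [x] and the one from
    [dy = 2x dx] supply the two factors ['X]. *)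
Lemma ip_laguerre_assoc P Q :
  ip `]0, +oo[ (laguerre_assoc Z) P Q =
  ip [set: R] W ((P \Po 'X^2) * 'X) ((Q \Po 'X^2) * 'X).
Proof.
apply/matrixP => i j; rewrite [RHS]ip_entry [LHS]mxE.
(* The pulled-back integrand carries one factor [x], so it is the integrand of an even polynomial
   against an odd one, and its measurability follows from [ip_integrable]. *)
pose g x := ip_integrand W (P \Po 'X^2) ((Q \Po 'X^2) * 'X) x i j.
pose h x := ip_integrand W ((P \Po 'X^2) * 'X) ((Q \Po 'X^2) * 'X) x i j.
pose f y := (P.[cmx y] *m laguerre_assoc Z y *m mx_ctrans Q.[cmx y]) i j.
have [gi1 gi2] : Cintegrable [set: R] g by exact: ip_integrable.
have [hi1 hi2] : Cintegrable [set: R] h by exact: ip_integrable.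
have mg1 : measurable_fun setT (fun x => complex.Re (g x)).
  by apply/measurable_EFinP; exact: measurable_int gi1.
have mg2 : measurable_fun setT (fun x => complex.Im (g x)).
  by apply/measurable_EFinP; exact: measurable_int gi2.
have gE x : g x = Cx x * sqr_integrand P Q x i j.
  by rewrite /g ip_integrand_mixed scalemx_entry.
have hg x : h x = Cx x * g x.
  by rewrite gE /h ip_integrand_odd scalemx_entry mulrA.
have hN x : h (- x) = h x.
  by rewrite !hg !gE sqr_integrandN CxN !mulNr mulrN opprK.
have fg y : 0 < y -> f y = g (Num.sqrt y).
  move=> y0; rewrite gE /f /sqr_integrand /laguerre_assoc hWZ.
  rewrite sqr_sqrtr ?ltW // CxM -[in LHS]scalemxAr -[in LHS]scalemxAl.
  rewrite -[in RHS]scalemxAr -[in RHS]scalemxAl !scalemx_entry.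
  by rewrite mulrA.
apply: complex_eq.
  apply: (Rintegral_sqr_subst _ _ _ mg1 hi1) => [y y0|x|x].
  - by rewrite -fg.
  - by rewrite hg Re_complexM /= mul0r subr0 mulrC.
  - by rewrite hN.
apply: (Rintegral_sqr_subst _ _ _ mg2 hi2) => [y y0|x|x].
- by rewrite -fg.
- by rewrite hg Im_complexM /= mul0r addr0 mulrC.
- by rewrite hN.
Qed.

End SymmetricWeight.

(** * Smooth functions *)

(** The analogue of [derivn_comp_sqrX] for real functions, at positive points, where [u] is
    smooth. *)
Lemma derive1n_comp_sqrX (R : realType) (u : R -> R) :
  (forall k y, 0 < y -> derivable (derive1n k u) y 1) ->
  forall i N x, (i < N)%N -> 0 < x ->
  derive1n i (fun t => t * u (t ^+ 2)) x =
  \sum_(m < N) derive1n m u (x ^+ 2) * (sqr_coef R i m).[x].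
Proof.
move=> du; elim=> [|i IH] N x iN x0.
  case: N iN => // N _; rewrite big_ord_recl big1 => [|m _]; last first.
    by rewrite /= horner0 mulr0.
  by rewrite /= hornerX addr0 mulrC.
case: N iN => // N iN.
rewrite derive1nS derive1E.
pose F (m : 'I_N.+1) : R -> R :=
  ((derive1n m u) \o (horner ('X^2 : {poly R}))) * horner (sqr_coef R i m).
(* The induction hypothesis holds only at positive points, which is enough near [x] to identify the
   derivatives. *)
have -> : 'D_1 (derive1n i (fun t => t * u (t ^+ 2))) x =
    'D_1 (\sum_(m < N.+1) F m) x.
  apply: near_eq_derive; near=> t.
  rewrite (IH N.+1) //; last first.
  - by near: t; exact: lt_nbhsr.
  - exact: ltnW.
  rewrite fct_sumE; apply: eq_bigr => m _.
  by rewrite /F /= fctE /= hornerXn.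
have dF (m : 'I_N.+1) : is_derive x 1 (F m)
  (derive1n m.+1 u (x ^+ 2) * ('X *+ 2 * sqr_coef R i m).[x] +
   derive1n m u (x ^+ 2) * (sqr_coef R i m)^`().[x]).
  have x20 : 0 < ('X^2 : {poly R}).[x] by rewrite hornerXn exprn_gt0.
  have d1 := derivableP (du m _ x20).
  apply: is_derive_eq.
  rewrite /GRing.scale /= -derive1E -derive1nS hornerXn derivXn.
  rewrite hornerM !hornerMn hornerX.
  by ring.
have -> : 'D_1 (\sum_(m < N.+1) F m) x = \sum_(m < N.+1)
    (derive1n m.+1 u (x ^+ 2) * ('X *+ 2 * sqr_coef R i m).[x] +
     derive1n m u (x ^+ 2) * (sqr_coef R i m)^`().[x]).
  exact: derive_val.
rewrite big_split /= addrC.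
under [RHS]eq_bigr do rewrite hornerD mulrDr.
rewrite big_split /=; congr (_ + _).
rewrite big_ord_recr [RHS]big_ord_recl /= sqr_coef_gt // mulr0 !horner0 !mulr0.
by rewrite addr0 add0r.
Unshelve. all: by end_near.
Qed.

Section SmoothAction.
Context {R : realType} {n : nat}.
Local Notation M := 'M[R[i]]_n.+1.

HB.instance Definition _ := GRing.RMorphism.copy (@cmx R n.+1)
  (@scalar_mx R[i] n.+1 \o @Cx R).

Lemma horner_cmx_sqr_coef i m (x : R) :
  (sqr_coef M i m).[cmx x] = cmx (sqr_coef R i m).[x].
Proof.
by rewrite -(map_sqr_coef R M (@cmx R n.+1)) horner_map.
Qed.

Lemma mxderivn_comp_sqrX (F : R -> M) i N x : mxsmooth `]0, +oo[ F ->
  (i < N)%N -> 0 < x ->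
  mxderivn i (fun t => Cx t *: F (t ^+ 2)) x =
  \sum_(m < N) mxderivn m F (x ^+ 2) * cmx (sqr_coef R i m).[x].
Proof.
move=> sF iN x0; apply/matrixP => a b; rewrite mxE summxE.
have y_in (y : R) : 0 < y -> (`]0, +oo[ : set R) y
  by rewrite /= in_itv /= andbT.
have d1 k y : 0 < y -> derivable (derive1n k (fun t => complex.Re (F t a b))) y 1.
  by move=> y0; have [] := sF a b k y (y_in y y0).
have d2 k y : 0 < y -> derivable (derive1n k (fun t => complex.Im (F t a b))) y 1.
  by move=> y0; have [] := sF a b k y (y_in y y0).
under [RHS]eq_bigr do rewrite -mulmxE mul_mx_scalar !mxE.
have reE : (fun t => complex.Re ((Cx t *: F (t ^+ 2)) a b)) =
    (fun t => t * complex.Re (F (t ^+ 2) a b)).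
  by apply/funext => t; rewrite mxE Re_complexM /= mul0r subr0.
have imE : (fun t => complex.Im ((Cx t *: F (t ^+ 2)) a b)) =
    (fun t => t * complex.Im (F (t ^+ 2) a b)).
  by apply/funext => t; rewrite mxE Im_complexM /= mul0r addr0.
apply: complex_eq.
  rewrite /= reE (derive1n_comp_sqrX _ _ d1 i N x iN x0).
  rewrite (big_morph _ (@Re_complexD R) (erefl : complex.Re (0 : R[i]) = 0)).
  by apply: eq_bigr => m _; rewrite Re_complexM /= mul0r subr0 mulrC.
rewrite /= imE (derive1n_comp_sqrX _ _ d2 i N x iN x0).
rewrite (big_morph _ (@Im_complexD R) (erefl : complex.Im (0 : R[i]) = 0)).
by apply: eq_bigr => m _; rewrite Im_complexM /= mul0r addr0 mulrC.
Qed.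

(** After multiplication by [x], both sides are sums over the derivatives of [F] at [y]; the oddness
    hypothesis pulls a factor [x] out of each coefficient. *)
Lemma actE_sqr_op (D : diffop R n) (F : R -> M) (y : R) :
  mxsmooth `]0, +oo[ F -> 0 < y ->
  (forall m, (m < size D)%N -> sqr_op_coef M D m =
     (odd_poly (sqr_op_coef M D m) \Po 'X^2) * 'X) ->
  actE D (fun x => F (x ^+ 2)) (Num.sqrt y) = actF (sqr_op M D) F y.
Proof.
move=> sF y0 oddD; set x := Num.sqrt y.
have x0 : 0 < x by rewrite sqrtr_gt0.
have x2 : x ^+ 2 = y by rewrite sqr_sqrtr // ltW.
have Cx0 : Cx x != 0 by rewrite fmorph_eq0 gt_eqF.
apply: (scalerI Cx0); rewrite /actE scalerA divff // scale1r.
rewrite /actF size_mkseq scaler_sumr.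
transitivity (\sum_(i < size D) \sum_(m < size D)
  mxderivn m F y * ((sqr_coef M i m).[cmx x] * (D`_i).[cmx x])).
  apply: eq_bigr => i _.
  rewrite (mxderivn_comp_sqrX F i (size D) x sF (ltn_ord i) x0) big_distrl /=.
  by apply: eq_bigr => m _; rewrite horner_cmx_sqr_coef x2 mulrA.
rewrite exchange_big; apply: eq_bigr => m _; rewrite -big_distrr /=.
rewrite nth_mkseq ?ltn_ord // scalerAr; congr (_ * _).
rewrite -x2 -horner_cmx_comp_sqr.
transitivity (sqr_op_coef M D m).[cmx x].
  by rewrite horner_sum; apply: eq_bigr => i _; rewrite horner_cmxM.
rewrite [in LHS]oddD ?ltn_ord // horner_cmxM hornerX -mulmxE.
by rewrite mul_mx_scalar.
Qed.

End SmoothAction.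

(** * The transformed operator belongs to the algebra of the Laguerre-type weight *)

Theorem theorem4p5 (R : realType) (N : nat)
  (W Z : R -> 'M[R[i]]_N.+1) (D : diffop R N)
  (hWZ : forall x : R, W x = Cx (expR (- x ^+ 2)) *: Z x)
  (hW : is_weight [set: R] W)
  (hsym : forall x : R, W x = W (- x))
  (hD : inD [set: R] W D) :
  exists Et : diffop R N,
    (forall Ft : R -> 'M[R[i]]_N.+1, mxsmooth `]0, +oo[ Ft ->
       forall y : R, 0 < y ->
         actF Et Ft y = actE D (fun x => Ft (x ^+ 2)) (Num.sqrt y)) /\
    inD `]0, +oo[ (laguerre_assoc Z) Et.
Proof.
have [A [Am Ao]] := exists_even_family W hW.
have [B [Bm Bo]] := exists_odd_family W hW.
have eigen (Q : nat -> {poly 'M[R[i]]_N.+1}) :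
    (forall k, Q k \is monic /\ size (Q k) = k.+1) ->
    (forall k l, k <> l ->
      ip [set: R] W ((Q k \Po 'X^2) * 'X) ((Q l \Po 'X^2) * 'X) = 0) ->
    forall k, exists c : 'M[R[i]]_N.+1,
      right_act _ ((Q k \Po 'X^2) * 'X) D = c%:P * ((Q k \Po 'X^2) * 'X).
  move=> Qm Qo k.
  (* The member of index [2k+1] of the interleaved sequence is [x Q_k(x^2)]. *)
  have [c] := hD _ (interleave_OPS W hW hsym A Q Am Qm Ao Qo) k.*2.+1.
  by rewrite /interleave /= odd_double uphalf_double => ec; exists c.
have M0 k (a : 'M[R[i]]_N.+1) : a *+ k.+1 = 0 -> a = 0.
  rewrite -scaler_nat => /eqP; rewrite scaler_eq0 pnatr_eq0 /=.
  by move/eqP.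
exists (sqr_op _ D); split.
  (* Any odd orthogonal family shows the coefficients to be odd; [B] serves here. *)
  move=> F sF y y0; apply/esym/actE_sqr_op => // m mD.
  exact: (sqr_op_coefE _ D M0 B Bm (eigen B Bm Bo) m mD).
move=> Q [Qm Qo] k.
(* A sequence orthogonal for the Laguerre-type weight is itself an odd family for [W], so [eigen]
   applies to it directly. *)
have Qo' j l : j <> l ->
    ip [set: R] W ((Q j \Po 'X^2) * 'X) ((Q l \Po 'X^2) * 'X) = 0.
  by move=> jl; rewrite -(ip_laguerre_assoc W hW hsym Z hWZ); exact: Qo.
have [c ec] := eigen Q Qm Qo' k; exists c.
exact: (right_act_sqr_op_eigen _ D M0 Q Qm (eigen Q Qm Qo') _ _ ec).
Qed.
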